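(* For $h\in\mathbb{Q}$ let $E_h$ be the curve $$E_h=\{(x+1)(y+1)(x+y+1)-hxy=0\},$$ and let $h_c^+=(11+5\sqrt5)/2$. There exist rational values of $h$ with $h>h_c^+$ such that the group $E_h(\mathbb{Q})$ has rank $0$.
   Context: $E_h$ is considered as the projective plane cubic $(x+z)(y+z)(x+y+z)-hxyz=0$, an elliptic curve over $\mathbb{Q}$ (for rational $h>h_c^+$) with neutral element $[1:-1:0]$; $E_h(\mathbb{Q})$ is its group of rational points. *)

(* Defs.v *)
From HB Require Import structures.
From mathcomp Require Import all_boot all_order all_algebra.
From mathcomp Require Import ring lra.

Set Implicit Arguments.
Unset Strict Implicit.
Unset Printing Implicit Defensive.

Import Order.TTheory GRing.Theory Num.Theory.
Local Open Scope ring_scope.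

(* Homogeneous coordinates (x, y, z). *)
Notation vec K := (K * K * K)%type.

Section Cubic.
Variables (K : fieldType) (h : K).
Implicit Types (v w : vec K) (s t : K).

Definition cubic v : K :=
  let: (x, y, z) := v in (x + z) * (y + z) * (x + y + z) - h * x * y * z.

Definition grad v : vec K :=
  let: (x, y, z) := v in
  ((y + z) * (x + y + z) + (x + z) * (y + z) - h * y * z,
   (x + z) * (x + y + z) + (x + z) * (y + z) - h * x * z,
   (y + z) * (x + y + z) + (x + z) * (x + y + z) + (x + z) * (y + z)
     - h * x * y).

Definition dot v w : K :=
  let: (a, b, c) := v in let: (x, y, z) := w in a * x + b * y + c * z.

Definition comb s v t w : vec K :=
  let: (a, b, c) := v in let: (x, y, z) := w in
  (s * a + t * x, s * b + t * y, s * c + t * z).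

(* The cubic along the line through v and w; the third intersection points   *)
(* below are read off from this expansion.                                    *)
Lemma cubic_comb s v t w :
  cubic (comb s v t w) =
    s ^+ 3 * cubic v + s ^+ 2 * t * dot (grad v) w
    + s * t ^+ 2 * dot (grad w) v + t ^+ 3 * cubic w.
Proof. by case: v => [[a b] c]; case: w => [[x y] z] /=; ring. Qed.

Lemma dot_grad v : dot (grad v) v = 3%:R * cubic v.
Proof. by case: v => [[a b] c] /=; ring. Qed.

(* A point of the projective plane is represented by its unique multiple of   *)
(* the form (x, y, 1), (1, y, 0) or (0, 1, 0).                                *)
Definition normal v : bool :=
  let: (x, y, z) := v in
  if z != 0 then z == 1 else if x != 0 then x == 1 else y == 1.

Definition normalize v : vec K :=
  let: (x, y, z) := v in
  if z != 0 then (x / z, y / z, 1)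
  else if x != 0 then (1, y / x, 0) else (0, y / y, 0).

(* E_h(K): the points (x, y, 1) are those of the affine curve; those with     *)
(* z = 0 are [1 : 0 : 0], [0 : 1 : 0] and [1 : -1 : 0].                       *)
Definition on_curve v : bool := normal v && (cubic v == 0).

Record curve := CurvePoint { coords :> vec K; coordsP : on_curve coords }.

HB.instance Definition _ := [isSub for coords].
HB.instance Definition _ := [Equality of curve by <:].

Lemma neutral_on_curve : on_curve (1, -1, 0).
Proof.
rewrite /on_curve /normal /cubic eqxx /= oner_eq0 /= eqxx /=.
by apply/eqP; ring.
Qed.

Definition neutral : curve := CurvePoint neutral_on_curve.

(* A point of the tangent line at the normalized point v, distinct from v:    *)
(* the coordinate of v that is normalized to 1 vanishes.                      *)
Definition tangent_point v : vec K :=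
  let: (x, y, z) := v in let: (a, b, c) := grad v in
  if z != 0 then (b, - a, 0) else if x != 0 then (0, c, - b) else (- c, 0, a).

(* Third intersection of the curve with the line through v and w, or with the *)
(* tangent line at v when v = w.                                              *)
Definition third_vec v w : vec K :=
  if v == w then
    let u := tangent_point v in comb (cubic u) v (- dot (grad u) v) u
  else comb (dot (grad w) v) v (- dot (grad v) w) w.

(* The default value is not used when h is a rational number > h_c^+: see     *)
(* [coords_third] and [smooth_gt_hc].                                         *)
Definition third (P Q : curve) : curve :=
  insubd neutral (normalize (third_vec P Q)).

(* Chord-tangent law; the neutral element is a flex, so -P is the third       *)
(* intersection of the line through P and the neutral element.                *)
Definition addE (P Q : curve) : curve := third (third P Q) neutral.
Definition oppE (P : curve) : curve := third P neutral.

Definition smooth : bool := (h != 0) && (h ^+ 2 - 11%:R * h - 1 != 0).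

Local Lemma lin3 (p q r a b c x : K) :
  a = 0 -> b = 0 -> c = 0 -> x = p * a + q * b + r * c -> x = 0.
Proof. by move=> -> -> -> ->; rewrite !mulr0 !addr0. Qed.

Lemma grad_neq0 v : smooth -> v != 0 -> cubic v = 0 -> grad v != 0.
Proof.
case/andP=> h0 disc v0 Cv; apply/eqP=> gv.
case: v v0 Cv gv => [[x y] z] v0 /= Cv [gx gy gz].
have [z0|z0] := eqVneq z 0.
  subst z.
  have x3 : x ^+ 3 = 0.
    by apply: (lin3 (p := 2%:R) (q := - 2%:R * x) (r := x) Cv gx gy); ring.
  have y3 : y ^+ 3 = 0.
    by apply: (lin3 (p := 2%:R) (q := y) (r := - 2%:R * y) Cv gx gy); ring.
  move/eqP: x3; move/eqP: y3; rewrite !expf_eq0 /= => /eqP y0 /eqP x0.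
  by move: v0; rewrite x0 y0 eqxx.
have: (x - y) * (x + y + z - h * z) = 0.
  by apply: (lin3 (p := - 1) (q := 1) (r := 0) gx gy gz); ring.
move/eqP; rewrite mulf_eq0 => /orP[]/eqP E; last first.
  have: h ^+ 2 * z ^+ 3 = 0.
    by apply: (lin3 (p := 1) (q := - ((x + z) * (y + z) + h * z ^+ 2)) (r := 0)
      Cv E gx); ring.
  by apply/eqP; rewrite mulf_neq0 ?expf_neq0.
have Exy : y = x by rewrite -[RHS]subr0 -E; ring.
subst y => {E}.
have: (x + z) * (x ^+ 2 - x * z - z ^+ 2) = 0.
  by apply: (lin3 (p := - 1) (q := x) (r := 0) Cv gx gy); ring.
move/eqP; rewrite mulf_eq0 => /orP[]/eqP e.
  have: h * z ^+ 2 = 0.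
    by apply: (lin3 (p := 1) (q := h * z - 3%:R * x - 2%:R * z) (r := 0)
      gx e gy); ring.
  by apply/eqP; rewrite mulf_neq0 ?expf_neq0.
have: (h ^+ 2 - 11%:R * h - 1) * z ^+ 3 = 0.
  pose k := 8%:R - h; pose m := k * x - 5%:R * z - k * z.
  by apply: (lin3 (p := m) (q := - 3%:R * m - k ^+ 2 * z) (r := 0) gx e gy);
     rewrite /m /k; ring.
by apply/eqP; rewrite mulf_neq0 ?expf_neq0.
Qed.

(* No line through a rational point v at infinity lies on the curve. *)
Local Lemma no_line_infty v w : h != 0 -> v.2 = 0 -> v != 0 -> w.2 != 0 ->
  cubic v = 0 -> dot (grad v) w = 0 -> dot (grad w) v = 0 -> cubic w != 0.
Proof.
move=> h0; case: v w => [[a b] c] [[x y] z] /= -> v0 z0 Cv gv gw.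
apply/eqP=> Cw.
have: a * b * (a + b) = 0.
  by apply: (lin3 (p := 1) (q := 0) (r := 0) Cv gv gw); ring.
have [a0|a0] := eqVneq a 0.
  subst a => _; have b0 : b != 0 by apply: contra_neq v0 => ->.
  have: b ^+ 2 * (h * z ^+ 2) = 0.
    by apply: (lin3 (p := b) (q := h * z - (x + y + z) - (y + z)) (r := 0)
      gw gv Cw); ring.
  by apply/eqP; rewrite !mulf_neq0 ?expf_neq0.
have [b0|b0] := eqVneq b 0.
  subst b => _; have: a ^+ 2 * (h * z ^+ 2) = 0.
    by apply: (lin3 (p := a) (q := h * z - (x + y + z) - (x + z)) (r := 0)
      gw gv Cw); ring.
  by apply/eqP; rewrite !mulf_neq0 ?expf_neq0.
move/eqP; rewrite !mulf_eq0 (negbTE a0) (negbTE b0) /= addrC addr_eq0.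
move=> /eqP Eb; subst b; have: a ^+ 2 * (h ^+ 2 * z ^+ 3) = 0.
  by apply: (lin3 (p := a ^+ 2) (q := (x + z) * (y + z) + h * z ^+ 2) (r := 0)
    Cw gv gw); ring.
by apply/eqP; rewrite !mulf_neq0 ?expf_neq0.
Qed.

Local Lemma no_line v w : h != 0 -> v != 0 -> w != 0 ->
  (forall s t, comb s v t w = 0 -> s = 0 /\ t = 0) ->
  cubic v = 0 -> dot (grad v) w = 0 -> dot (grad w) v = 0 -> cubic w != 0.
Proof.
move=> h0 v0 w0 indep Cv gv gw; apply/eqP=> Cw.
have line s t : cubic (comb s v t w) = 0.
  by rewrite cubic_comb Cv gv gw Cw !mulr0 !addr0.
have [vz|vz] := eqVneq v.2 0; last first.
  pose u := comb w.2 v (- v.2) w.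
  have u0 : u != 0.
    by apply/eqP=> /indep[_ /eqP]; rewrite oppr_eq0 (negbTE vz).
  have uz : u.2 = 0.
    by rewrite /u; case: (v) (w) => [[? ?] ?] [[? ?] ?] /=; ring.
  have gu : dot (grad u) v = 0.
    apply: (lin3 (p := 3%:R * w.2 ^+ 2) (q := - 2%:R * w.2 * v.2)
      (r := v.2 ^+ 2) Cv gv gw).
    by rewrite /u; case: (v) (w) => [[? ?] ?] [[? ?] ?] /=; ring.
  have gvu : dot (grad v) u = 0.
    apply: (lin3 (p := 3%:R * w.2) (q := - v.2) (r := 0) Cv gv gw).
    by rewrite /u; case: (v) (w) => [[? ?] ?] [[? ?] ?] /=; ring.
  by have /eqP := no_line_infty h0 uz u0 vz (line _ _) gu gvu.
have [wz|wz] := eqVneq w.2 0; last first.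
  by have /eqP := no_line_infty h0 vz v0 wz Cv gv gw.
case: v w vz wz indep v0 w0 Cv Cw gv gw {line} =>
  [[a b] c] [[x y] z] /= -> -> indep v0 w0 Cv Cw gv gw.
have [D|D] := eqVneq (a * y - b * x) 0.
  have [x0|x0] := eqVneq x 0; last first.
    have [] := indep x (- a); last by move=> /eqP; rewrite (negbTE x0).
    congr (_, _, _); [ring| |ring].
    by apply: (lin3 (p := -1) (q := 0) (r := 0) D Cv gv); ring.
  have [] := indep y (- b).
    congr (_, _, _); [|ring|ring].
    by apply: (lin3 (p := 1) (q := 0) (r := 0) D Cv gv); ring.
  by move=> y0; move: w0; rewrite x0 y0 eqxx.
have a3 : a ^+ 3 = 0.
  apply: (mulfI D); rewrite mulr0.
  by apply: (lin3 (p := 2%:R * (a * y - b * x) - 3%:R * a * x - 6%:R * a * y)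
    (q := a ^+ 2 + 2%:R * a * b) (r := 0) Cv gv gw); ring.
have b3 : b ^+ 3 = 0.
  apply: (mulfI D); rewrite mulr0.
  by apply: (lin3 (p := 2%:R * (a * y - b * x) + 3%:R * b * y + 6%:R * b * x)
    (q := - b ^+ 2 - 2%:R * a * b) (r := 0) Cv gv gw); ring.
move/eqP: a3; move/eqP: b3; rewrite !expf_eq0 /=.
by move=> /eqP b0 /eqP a0; move: v0; rewrite a0 b0 eqxx.
Qed.

Local Lemma normal_neq0 v : normal v -> v != 0.
Proof.
by apply: contraL => /eqP->; rewrite /= !eqxx /= eq_sym oner_eq0.
Qed.

Local Lemma normalize_on_curve v :
  v != 0 -> cubic v = 0 -> on_curve (normalize v).
Proof.
case: v => [[x y] z] v0 Cv; rewrite /on_curve /normalize.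
have [z0|z0] := eqVneq z 0; last first.
  rewrite /= oner_eq0 eqxx /=; apply/eqP; apply: (mulfI (expf_neq0 3 z0)).
  by rewrite [RHS]mulr0 -[RHS]Cv /=; field.
have [x0|x0] := eqVneq x 0; last first.
  rewrite /= oner_eq0 !eqxx /=; apply/eqP; apply: (mulfI (expf_neq0 3 x0)).
  by rewrite [RHS]mulr0 -[RHS]Cv z0 /=; field.
have y0 : y != 0 by apply: contra_neq v0 => y0; rewrite x0 y0 z0.
rewrite divff //= !eqxx /=; apply/eqP; ring.
Qed.

Local Lemma normal_scale k v : normal v -> normal (comb k v 0 v) ->
  comb k v 0 v = v.
Proof.
case: v => [[a b] c]; rewrite /comb !mul0r !addr0 /normal.
have [->|c0] := eqVneq c 0.
  rewrite mulr0 eqxx /=; have [->|a0] := eqVneq a 0.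
    rewrite mulr0 eqxx /= => /eqP->; rewrite mulr1 => /eqP->.
    by [].
  move/eqP->; rewrite mulr1; have [->|k0] := eqVneq k 0; rewrite /=.
    by rewrite mul0r eq_sym oner_eq0.
  by move/eqP->; rewrite mul1r.
rewrite /= => /eqP->; rewrite mulr1; have [->|k0] := eqVneq k 0; rewrite /=.
  by rewrite !mul0r eqxx /= eq_sym oner_eq0.
by move/eqP->; rewrite !mul1r.
Qed.

Local Lemma normal_indep v w s t : normal v -> normal w -> v != w ->
  comb s v t w = 0 -> s = 0 /\ t = 0.
Proof.
move=> nv nw vw E; suff t0 : t = 0.
  split=> //; apply/eqP; apply: contraNT (normal_neq0 nv) => s0.
  move: E; rewrite t0; case: v w {nv nw vw} => [[a b] c] [[x y] z] [e1 e2 e3].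
  apply/eqP; congr (_, _, _); apply: (mulfI s0); rewrite mulr0.
  - by rewrite -[RHS]e1; ring.
  - by rewrite -[RHS]e2; ring.
  by rewrite -[RHS]e3; ring.
apply/eqP; apply: contraNT vw => t0.
suff Ew : w = comb (- s / t) v 0 v by rewrite Ew normal_scale // -Ew.
case: v w E {nv nw} => [[a b] c] [[x y] z] [e1 e2 e3].
have sol p q : s * p + t * q = 0 -> q = - s / t * p + 0 * p.
  move=> e; apply: (mulfI t0); apply/eqP; rewrite -subr_eq0 -[X in _ == X]e.
  by apply/eqP; field.
by congr (_, _, _); apply: sol.
Qed.

Local Lemma tangent_point_indep v s t : smooth -> normal v -> cubic v = 0 ->
  comb s v t (tangent_point v) = 0 -> s = 0 /\ t = 0.
Proof.
move=> sm nv Cv; have := grad_neq0 sm (normal_neq0 nv) Cv.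
have := dot_grad v; rewrite Cv mulr0 /tangent_point.
case: v nv {Cv} => [[x y] z]; case: (grad _) => [[a b] c].
rewrite /normal /dot.
have [z0|z0] := eqVneq z 0; rewrite /=; last first.
  move/eqP=> -> E g0 [e1 e2 e3].
  have s0 : s = 0 by rewrite -[RHS]e3; ring.
  split=> //; apply/eqP; apply: contraNT g0 => t0.
  have b0 : b = 0 by apply: (mulfI t0); rewrite mulr0 -[RHS]e1 s0; ring.
  have a0 : a = 0.
    by apply: (mulfI t0); rewrite mulr0 -[RHS]oppr0 -[in RHS]e2 s0; ring.
  by apply/eqP; congr (_, _, _) => //; rewrite -[RHS]E a0 b0; ring.
have [x0|x0] := eqVneq x 0; rewrite /=; last first.
  move/eqP=> -> E g0 [e1 e2 e3].
  have s0 : s = 0 by rewrite -[RHS]e1; ring.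
  split=> //; apply/eqP; apply: contraNT g0 => t0.
  have c0 : c = 0 by apply: (mulfI t0); rewrite mulr0 -[RHS]e2 s0; ring.
  have b0 : b = 0.
    by apply: (mulfI t0); rewrite mulr0 -[RHS]oppr0 -[in RHS]e3 s0; ring.
  by apply/eqP; congr (_, _, _) => //; rewrite -[RHS]E b0 c0; ring.
move/eqP=> -> E g0 [e1 e2 e3].
have s0 : s = 0 by rewrite -[RHS]e2; ring.
split=> //; apply/eqP; apply: contraNT g0 => t0.
have a0 : a = 0 by apply: (mulfI t0); rewrite mulr0 -[RHS]e3 s0; ring.
have c0 : c = 0.
  by apply: (mulfI t0); rewrite mulr0 -[RHS]oppr0 -[in RHS]e1 s0; ring.
by apply/eqP; congr (_, _, _) => //; rewrite -[RHS]E a0 c0; ring.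
Qed.

Local Lemma dot_tangent_point v : dot (grad v) (tangent_point v) = 0.
Proof.
rewrite /tangent_point; case: v => [[x y] z]; case: (grad _) => [[a b] c].
by case: ifP => _; [|case: ifP => _] => /=; ring.
Qed.

Local Lemma comb_neq0 v w : h != 0 ->
  (forall s t, comb s v t w = 0 -> s = 0 /\ t = 0) ->
  cubic v = 0 -> dot (grad v) w = 0 ->
  comb (cubic w) v (- dot (grad w) v) w != 0.
Proof.
move=> h0 indep Cv gv; apply/eqP=> /indep[Cw /eqP].
rewrite oppr_eq0 => /eqP gw; move/eqP: Cw; apply/negP.
have /eqP n10 : (1 : K) <> 0 by apply/eqP; rewrite oner_eq0.
have [v0 w0] : v != 0 /\ w != 0.
  split; apply/eqP => e0.
    have [] := indep 1 0; last by move/eqP; rewrite (negbTE n10).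
    by rewrite e0; case: (w) => [[? ?] ?] /=; congr (_, _, _); ring.
  have [] := indep 0 1; last by move=> _ /eqP; rewrite (negbTE n10).
  by rewrite e0; case: (v) => [[? ?] ?] /=; congr (_, _, _); ring.
exact: (no_line h0 v0 w0 indep Cv gv gw).
Qed.

Local Lemma third_vec_neq0 (P Q : curve) : smooth -> third_vec P Q != 0.
Proof.
move=> sm; have /andP[h0 _] := sm; rewrite /third_vec.
have /andP[nP /eqP CP] := coordsP P; have /andP[nQ /eqP CQ] := coordsP Q.
have [_|PQ] := eqVneq (coords P) (coords Q).
  apply: comb_neq0 (dot_tangent_point _) => // s t.
  exact: tangent_point_indep.
have indep s t : comb s P t Q = 0 -> s = 0 /\ t = 0 by exact: normal_indep.
apply/eqP=> /indep[gQ /eqP]; rewrite oppr_eq0 => /eqP gP.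
suff /eqP[] : cubic Q != 0 by [].
by apply: (no_line h0 (normal_neq0 nP) (normal_neq0 nQ) indep CP gP gQ).
Qed.

Local Lemma cubic_third_vec (P Q : curve) : cubic (third_vec P Q) = 0.
Proof.
have /andP[_ /eqP CP] := coordsP P; have /andP[_ /eqP CQ] := coordsP Q.
rewrite /third_vec; case: eqP => _; rewrite cubic_comb ?CP ?CQ; last by ring.
by rewrite dot_tangent_point; ring.
Qed.

Lemma coords_third (P Q : curve) :
  smooth -> coords (third P Q) = normalize (third_vec P Q).
Proof.
move=> sm; rewrite /third val_insubd normalize_on_curve //.
  exact: third_vec_neq0.
exact: cubic_third_vec.
Qed.

End Cubic.

Section Rank.
Variables (T : Type) (zero : T) (add : T -> T -> T) (opp : T -> T).

Definition zmul (n : int) (P : T) : T :=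
  match n with
  | Posz k => iter k (add P) zero
  | Negz k => opp (iter k.+1 (add P) zero)
  end.

Definition independent (r : nat) (P : 'I_r -> T) : Prop :=
  forall n : 'I_r -> int,
    \big[add/zero]_(i < r) zmul (n i) (P i) = zero -> forall i, n i = 0.

(* The maximal number of Z-linearly independent elements of the abelian group *)
(* (T, zero, add, opp) is r.                                                  *)
Definition has_rank (r : nat) : Prop :=
  (exists P : 'I_r -> T, independent P) /\
  (forall (k : nat) (P : 'I_k -> T), independent P -> (k <= r)%N).

End Rank.

Definition mordell_weil_rank (h : rat) (r : nat) : Prop :=
  has_rank (neutral h) (@addE _ h) (@oppE _ h) r.

Definition hc_plus (R : rcfType) : R :=
  (11%:R + 5%:R * Num.sqrt 5%:R) / 2%:R.

Lemma smooth_gt_hc (R : rcfType) (h : rat) : hc_plus R < ratr h -> smooth h.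
Proof.
rewrite /hc_plus; set r := Num.sqrt _ => lt_h.
have r0 : 0 <= r := sqrtr_ge0 _.
have r2 : r ^+ 2 = 5%:R by rewrite sqr_sqrtr ?ler0n.
rewrite -(ltr_pM2r (x := 2%:R)) ?ltr0n // divfK ?pnatr_eq0 // in lt_h.
have h0 : 0 < ratr h :> R by lra.
apply/andP; split; first by move: h0; rewrite ltr0q; apply: lt0r_neq0.
apply/eqP=> /(congr1 (ratr : rat -> R)).
rewrite !rmorphB rmorphXn rmorphM /= rmorph1 rmorph0 ratr_nat => e.
nra.
Qed.

(* Main.v *)
(* Take h = 12. With s = x + y, the point X = 64 (2 - s) / (11 - s) lies on     *)
(* E : Y^2 = X (X^2 + 25 X - 512), so it suffices to show that the only rational *)
(* points of E are the ten torsion points. This is a descent by the 2-isogeny    *)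
(* to E' : Y^2 = X (X^2 - 50 X + 2673): up to squares, X divides 512, resp. 2673 *)
(* = 3^5 11, and congruences mod 3, resp. mod 16, leave only the classes of the  *)
(* 2-torsion. Hence every point with X = w^2 is the double of such a point       *)
(* w1^2, and w = (w1^4 + 512) / (2 w1 v1) has bounded cancellation, so that the  *)
(* numerator of w1 is smaller than the one of w apart from finitely many w1.     *)

From Stdlib Require Import ZArith.
Require Import Defs.
From mathcomp Require Import all_boot all_order all_algebra.
From mathcomp Require Import ring lra zify.

Set Implicit Arguments.
Unset Strict Implicit.
Unset Printing Implicit Defensive.

Import Order.TTheory GRing.Theory Num.Theory.
Local Open Scope ring_scope.

(** For [h = 12] the curve has exactly ten rational points, all killed by 10, so every nonempty
    family of points satisfies a nontrivial relation. The link with E is a discriminant: x and y are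
    the roots of a quadratic with coefficients in s = x + y, and requiring its discriminant to be a
    square gives E after a change of variable ([affine_points]). On E and on E', translation by the
    2-torsion point (0, 0) sends X to b / X, where b = -512, resp. 2673. [square_class_25] and
    [square_class_50] say that, up to this translation, every nonzero X is a square, which makes the
    point an image under the isogeny from the other curve. Applying this twice, [descent] halves any
    point with X = w^2. Halving cannot go on forever: by [doubling_height] and [size_bound], either
    the numerator decreases or w1 lies in a finite box, searched by [search_okP]. This gives X = 16
    or 64 in [quartic_points], hence all X in [weierstrass_points], then the list in
    [coords_points], whose torsion is checked by computation. *)

(** * Square classes of x-coordinates on Y^2 = X (X^2 + a X + b) *)

(** Dividing both factors by their gcd leaves coprime numbers a', b' with a' b' = m^2, and then a'
    is the square of gcd(a', m). *)
Lemma square_factor (a b n : nat) : (0 < a)%N -> (a * b = n ^ 2)%N ->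
  exists k : nat, a = (gcdn a b * k ^ 2)%N.
Proof.
move=> a0 E; have g0 : (0 < gcdn a b)%N by rewrite gcdn_gt0 a0.
have [/dvdnP[a' Ea] /dvdnP[b' Eb]] := (dvdn_gcdl a b, dvdn_gcdr a b).
set g := gcdn a b in g0 Ea Eb *.
have co : coprime a' b'.
  by rewrite /coprime -(eqn_pmul2r g0) mul1n muln_gcdl -Ea -Eb.
have /dvdnP[m Em] : (g %| n)%N.
  by rewrite -(@dvdn_pexp2r _ _ 2) // -E Ea Eb mulnACA mulnn dvdn_mull.
have Em2 : (a' * b' = m ^ 2)%N.
  apply/eqP; rewrite -(@eqn_pmul2r (g ^ 2)) ?expn_gt0 ?g0 //.
  by rewrite -expnMn -Em -E Ea Eb; apply/eqP; ring.
have a'0 : (0 < a')%N by move: a0; rewrite Ea muln_gt0 => /andP[].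
exists (gcdn a' m); rewrite {1}Ea mulnC; congr (_ * _)%N.
have k0 : (0 < gcdn a' m)%N by rewrite gcdn_gt0 a'0.
have [/dvdnP[a2 Ea2] /dvdnP[m2 Em']] := (dvdn_gcdl a' m, dvdn_gcdr a' m).
set k := gcdn a' m in k0 Ea2 Em' *.
have co2 : coprime a2 m2.
  by rewrite /coprime -(eqn_pmul2r k0) mul1n muln_gcdl -Ea2 -Em'.
have E2 : (a2 * b' = k * m2 ^ 2)%N.
  apply/eqP; rewrite -(eqn_pmul2r k0); apply/eqP; transitivity (a' * b')%N.
    by rewrite Ea2; ring.
  by rewrite Em2 Em'; ring.
suff E3 : a2 = k by rewrite Ea2 E3 mulnn.
apply/eqP; rewrite eqn_dvd; apply/andP; split.
  by rewrite -(@Gauss_dvdl _ _ (m2 ^ 2)) ?coprimeXr // -E2 dvdn_mulr.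
rewrite -(@Gauss_dvdl _ _ b') ?E2 ?dvdn_mulr //.
by apply: coprime_dvdl co; rewrite Ea2 dvdn_mull.
Qed.

Lemma rat_sqr_int (x : rat) (n : int) : x ^+ 2 = n%:~R -> exists m : int, x = m%:~R.
Proof.
move=> E; exists (numq x).
have d0 : (denq x)%:~R != 0 :> rat by rewrite intr_eq0 denq_neq0.
have Ed : (numq x ^+ 2)%:~R = (n * denq x ^+ 2)%:~R :> rat.
  by rewrite [LHS]rmorphXn [RHS]rmorphM rmorphXn /= -E numqE exprMn.
have /(congr1 absz) := intr_inj Ed; rewrite abszM !abszX => En.
have : (`|denq x| ^ 2 %| `|numq x| ^ 2)%N by rewrite En dvdn_mull.
rewrite dvdn_pexp2r // => dn.
have : `|denq x|%N == 1%N.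
  by rewrite -dvdn1 -(eqP (coprime_num_den x)) dvdn_gcd dn dvdnn.
move=> /eqP d1; rewrite numqE; have -> : denq x = 1 by have := denq_gt0 x; lia.
by rewrite mulr1.
Qed.

Lemma rat_frac (x : rat) : exists c d : int,
  [/\ x = c%:~R / d%:~R, coprimez c d & 0 < d].
Proof.
exists (numq x), (denq x); split; rewrite ?denq_gt0 //.
  by rewrite divq_num_den.
exact: coprime_num_den.
Qed.

(** Write x = c / d in lowest terms, so that c d q is a square. Since d is coprime to c and to q, it
    is a square; gcd(c, q) is coprime to d and divides b d^2, hence b, and c is this gcd times a
    square, up to sign. *)
Lemma square_class (a b : int) (x y : rat) : x != 0 ->
  x * (x ^+ 2 + a%:~R * x + b%:~R) = y ^+ 2 ->
  exists (g : int) (t : rat), [/\ (g %| b)%Z, t != 0 & x = g%:~R * t ^+ 2].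
Proof.
have [c [d [-> cd d0]]] := rat_frac x => x0 E.
have dq0 : d%:~R != 0 :> rat by rewrite intr_eq0 gt_eqF.
have c0 : c != 0 by apply: contra_neq x0 => ->; rewrite mul0r.
pose q := c ^+ 2 + a * c * d + b * d ^+ 2.
have [n En] : exists n : int, y * d%:~R ^+ 2 = n%:~R.
  apply: (@rat_sqr_int _ (c * (d * q))); rewrite exprMn -E /q.
  by rewrite !(rmorphM, rmorphD, rmorphXn) /=; field.
have Ecdq : c * (d * q) = n ^+ 2.
  apply: (@intr_inj rat); rewrite [RHS]rmorphXn /= -En exprMn -E /q.
  by rewrite !(rmorphM, rmorphD, rmorphXn) /=; field.
move/(congr1 absz): Ecdq; rewrite !abszM => Ecdq.
have c0' : (0 < `|c|)%N by rewrite absz_gt0.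
have d0' : (0 < `|d|)%N by rewrite absz_gt0 gt_eqF.
have [k Ek] := square_factor c0' Ecdq.
have [l El] := square_factor d0' (etrans (mulnCA _ _ _) Ecdq).
move: Ek El; rewrite !Gauss_gcdr ?(coprime_sym `|d|) // => Ek El.
have gc := dvdn_gcdl `|c| `|q|; have gq := dvdn_gcdr `|c| `|q|.
have gd : coprime (gcdn `|c| `|q|) `|d| := coprime_dvdl gc cd.
have {gq} gb : (gcdn `|c| `|q| %| `|b|)%N.
  rewrite -(@Gauss_dvdl _ _ (`|d| ^ 2)) ?coprimeXr // -abszX -abszM.
  have -> : b * d ^+ 2 = q - c * (c + a * d) by rewrite /q; ring.
  suff: ((gcdn `|c| `|q|)%:Z %| q - c * (c + a * d))%Z by [].
  by rewrite rpredB // dvdz_mulr.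
have dq1 : coprime `|d| `|q|.
  have -> : q = c ^+ 2 + (a * c + b * d) * d by rewrite /q; ring.
  suff: coprimez d (c ^+ 2 + (a * c + b * d) * d) by [].
  by rewrite /coprimez addrC gcdzMDl -/(coprimez _ _) coprimezXr // coprimez_sym.
rewrite (eqP dq1) mul1n in El.
have l0 : l != 0%N by apply: contraTneq d0' => l0; rewrite El l0.
have k0 : k != 0%N by apply: contraTneq c0' => k0; rewrite Ek k0 muln0.
set g := gcdn _ _ in gb Ek *.
exists (Num.sg c * g%:Z), (k%:Z%:~R / l%:Z%:~R); split.
- by rewrite dvdzE abszM absz_sg c0 mul1n.
- by rewrite mulf_neq0 ?invr_eq0 ?intr_eq0.
rewrite -{1}(gtz0_abs d0) El {1}[c]intEsg Ek.
rewrite !(rmorphM, rmorphXn, PoszM) /= ?rmorphXn ?rmorphM /= sgrz.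
by field; rewrite ?pnatr_eq0 ?intr_eq0.
Qed.

Lemma quartic_frac (a b c : int) (t y : rat) :
  a%:~R * t ^+ 4 + b%:~R * t ^+ 2 + c%:~R = y ^+ 2 ->
  exists2 n : int, y * (denq t)%:~R ^+ 2 = n%:~R
    & a * numq t ^+ 4 + b * numq t ^+ 2 * denq t ^+ 2 + c * denq t ^+ 4 = n ^+ 2.
Proof.
move=> E; set r := numq t; set s := denq t.
have s0 : s%:~R != 0 :> rat by rewrite intr_eq0 denq_neq0.
pose q := a * r ^+ 4 + b * r ^+ 2 * s ^+ 2 + c * s ^+ 4.
have Eq : (y * s%:~R ^+ 2) ^+ 2 = q%:~R.
  have Et : t = r%:~R / s%:~R by rewrite divq_num_den.
  rewrite exprMn -E Et /q.
  by rewrite !(rmorphM, rmorphD, rmorphXn) /=; field.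
have [n En] := rat_sqr_int Eq; exists n => //.
by apply: (@intr_inj rat); rewrite [RHS]rmorphXn /= -En Eq.
Qed.

(** * Local obstructions at 3 and 2, and the classes that survive on E and E' *)

Lemma sqr_mod3 (x : int) : exists a : int, x = 3 * a \/ x ^+ 2 = 3 * a + 1.
Proof.
have [a [->|[->|->]]] : exists a : int, x = 3 * a \/ x = 3 * a + 1 \/ x = 3 * a + 2.
- by exists (x %/ 3)%Z; lia.
- by exists a; left.
- by exists (3 * a ^+ 2 + 2 * a); right; ring.
by exists (3 * a ^+ 2 + 4 * a + 1); right; ring.
Qed.

(** Modulo 3 the form is (r^2 + s^2)^2 + n^2, and a sum of two squares vanishes modulo 3 only if
    both terms do. *)
Lemma no_quartic_mod3 (r s n : int) : coprimez r s ->
  (3 %| r ^+ 4 - r ^+ 2 * s ^+ 2 + s ^+ 4 + n ^+ 2)%Z -> False.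
Proof.
rewrite -[4%N]/(2 * 2)%N !exprM => co /dvdzP[k].
have [[[a Ha] [b Hb]] [c Hc]] := (sqr_mod3 r, sqr_mod3 s, sqr_mod3 n).
case: Ha => Ha; case: Hb => Hb.
  by move: co; rewrite /coprimez Ha Hb -mulz_gcdr; lia.
all: by case: Hc => Hc; rewrite Ha Hb Hc; lia.
Qed.

Lemma sqr_mod8 (x : int) : exists a : int, x = 2 * a \/ x ^+ 2 = 8 * a + 1.
Proof.
have [a [->|->]] : exists a : int, x = 2 * a \/ x = 2 * a + 1.
- by exists (x %/ 2)%Z; lia.
- by exists a; left.
have [b [->|->]] : exists b : int, a = 2 * b \/ a = 2 * b + 1.
- by exists (a %/ 2)%Z; lia.
- by exists (2 * b ^+ 2 + b); right; ring.
by exists (2 * b ^+ 2 + 3 * b + 1); right; ring.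
Qed.

(** If exactly one of r, s is odd, the left side is 3 modulo 8; if both are, it is 12 modulo 16.
    Neither is a square. *)
Lemma no_quartic_mod16 (r s n : int) : coprimez r s ->
  3 * r ^+ 4 - 50 * r ^+ 2 * s ^+ 2 + 891 * s ^+ 4 = n ^+ 2 -> False.
Proof.
rewrite -[4%N]/(2 * 2)%N !exprM => co.
have [[[a Ha] [b Hb]] [c Hc]] := (sqr_mod8 r, sqr_mod8 s, sqr_mod8 n).
case: Ha => Ha; case: Hb => Hb.
  by move: co; rewrite /coprimez Ha Hb -mulz_gcdr; lia.
all: case: Hc => Hc; rewrite Ha Hb Hc; try lia.
by have [d Hd] := sqr_mod8 c; case: Hd => Hd; rewrite exprMn Hd; lia.
Qed.

(** The classes are 1, -1, 2, -2. Here -2 is the class of -512, that is of (0, 0), while -1 and 2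
    both lead to the quartic of [no_quartic_mod3]. *)
Lemma square_class_25 (x y : rat) : x != 0 ->
  x * (x ^+ 2 + 25%:R * x - 512%:R) = y ^+ 2 ->
  exists2 w, w != 0 & x = w ^+ 2 \/ x = - 512%:R / w ^+ 2.
Proof.
move=> x0 E.
have [|g [t [g512 t0 Ex]]] := @square_class 25 (- 512) x y x0.
  by rewrite -E; ring.
have {g512} [i Eg] : exists i, `|g|%N = (2 ^ i)%N.
  have /(@dvdn_pfactor 2 `|g| 9)[//|i _ Eg] : (`|g| %| 2 ^ 9)%N by exact: g512.
  by exists i.
pose w := 2 ^+ i./2 * t.
have w0 : w != 0 by rewrite mulf_neq0 ?expf_neq0.
have {Ex} Ex : x = (sgz g)%:~R * 2 ^+ odd i * w ^+ 2.
  have -> : x = (sgz g)%:~R * 2 ^+ i * t ^+ 2.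
    by rewrite Ex {1}[g]intEsg Eg rmorphM /= -pmulrn natrX.
  rewrite -{1}(odd_double_half i) exprD -muln2 exprM /w; ring.
have sg : sgz g = 1 \/ sgz g = -1.
  case: sgzP => //; [|by left|by right].
  by move=> g0; move: Eg (expn_gt0 2 i); rewrite g0 => <-.
case: sg Ex => ->; case: odd => Ex.
- have [|n _ En] := @quartic_frac 2 25 (- 256) w (y / (2 * w)).
    by rewrite expr_div_n -E Ex; field.
  case: (no_quartic_mod3 (n := n) (coprime_num_den w)); rewrite -En.
  apply/dvdzP; exists (numq w ^+ 4 + 8 * numq w ^+ 2 * denq w ^+ 2
    - 85 * denq w ^+ 4).
  by ring.
- by exists w => //; left; rewrite Ex; ring.
- exists (16 / w); first by rewrite mulf_neq0 ?invr_eq0.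
  by right; rewrite Ex; field.
have [|n _ En] := @quartic_frac (- 1) 25 512 w (y / w).
  by rewrite expr_div_n -E Ex; field.
case: (no_quartic_mod3 (n := n) (coprime_num_den w)); rewrite -En.
by apply/dvdzP; exists (8 * numq w ^+ 2 * denq w ^+ 2 + 171 * denq w ^+ 4); ring.
Qed.

Lemma no_class_3 (t y : rat) :
  3%:R * t ^+ 4 - 50%:R * t ^+ 2 + 891%:R = y ^+ 2 -> False.
Proof.
move=> E; have [|n _ En] := @quartic_frac 3 (- 50) 891 t y.
  by rewrite -E; ring.
by apply: (no_quartic_mod16 (n := n) (coprime_num_den t)); rewrite -En; ring.
Qed.

Lemma square_class_50 (x y : rat) : x != 0 ->
  x * (x ^+ 2 - 50%:R * x + 2673%:R) = y ^+ 2 ->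
  exists2 u, u != 0 & x = u ^+ 2 \/ x = 2673%:R / u ^+ 2.
Proof.
move=> x0 E.
have [|g [t [g2673 t0 Ex]]] := @square_class (- 50) 2673 x y x0.
  by rewrite -E; ring.
(* The quadratic factor is (x - 25)^2 + 2048, which rules out negative classes. *)
have x_gt0 : 0 < x.
  have q0 : 0 < x ^+ 2 - 50%:R * x + 2673%:R by nra.
  rewrite -(pmulr_lgt0 _ q0) E lt0r sqr_ge0 andbT -E mulf_neq0 //.
  exact: lt0r_neq0.
have g0 : 0 < g.
  by move: x_gt0; rewrite Ex pmulr_lgt0 ?ltr0z // lt0r sqr_ge0 expf_neq0.
have {g2673} : `|g|%N \in divisors 2673 by rewrite -dvdn_divisors.
rewrite -(gtz0_abs g0) in Ex.
have -> : divisors 2673 = [:: 1; 3; 9; 11; 27; 33; 81; 99; 243; 297; 891; 2673]%N.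
  by vm_compute.
have sq m : m != 0 -> x = (m * t) ^+ 2 ->
    exists2 u, u != 0 & x = u ^+ 2 \/ x = 2673%:R / u ^+ 2.
  by move=> m0 ?; exists (m * t); [rewrite mulf_neq0 | left].
have sq3 m : m != 0 -> x <> 3%:R * (m * t) ^+ 2.
  move=> m0 Exm.
  apply: (@no_class_3 (m * t) (y / (3%:R * (m * t)))).
  by rewrite expr_div_n -E Exm; field; rewrite ?t0 ?m0.
(* The class of 2673 is 33, so translation by (0, 0) exchanges the classes 11 and 3. *)
have sq11 m : m != 0 -> x <> 11%:R * (m * t) ^+ 2.
  move=> m0 Exm.
  apply: (@no_class_3 (9 / (m * t)) (9 * (y / (11%:R * (m * t) ^+ 3)))).
  by rewrite [RHS]exprMn [in RHS]expr_div_n -E Exm; field; rewrite ?t0 ?m0.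
have sq33 m : m != 0 -> x = 33%:R * (m * t) ^+ 2 ->
    exists2 u, u != 0 & x = u ^+ 2 \/ x = 2673%:R / u ^+ 2.
  move=> m0 Exm; exists (9 / (m * t)).
    by rewrite !mulf_neq0 ?invr_eq0 ?mulf_neq0.
  by right; rewrite Exm; field; rewrite t0 m0.
rewrite !inE; do 11?[case/orP]; move/eqP=> Eg; rewrite Eg in Ex.
- by apply: (sq 1); [|rewrite Ex; ring].
- by case: (sq3 1); [|rewrite Ex; ring].
- by apply: (sq 3%:R); [|rewrite Ex; ring].
- by case: (sq11 1); [|rewrite Ex; ring].
- by case: (sq3 3%:R); [|rewrite Ex; ring].
- by apply: (sq33 1); [|rewrite Ex; ring].
- by apply: (sq 9%:R); [|rewrite Ex; ring].
- by case: (sq11 3%:R); [|rewrite Ex; ring].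
- by case: (sq3 9%:R); [|rewrite Ex; ring].
- by apply: (sq33 3%:R); [|rewrite Ex; ring].
- by case: (sq11 9%:R); [|rewrite Ex; ring].
by apply: (sq33 9%:R); [|rewrite Ex; ring].
Qed.

(** * Halving a point through the two isogenies *)

(** In both cases u^2 is one of the roots p, p' of T^2 - (4 w^2 + 2 a) T + b'. *)
Lemma isogeny_quartic (F : fieldType) (a b' p p' w u : F) :
  p * p' = b' -> p + p' = 4%:R * w ^+ 2 + 2%:R * a -> u != 0 -> b' != 0 ->
  p = u ^+ 2 \/ p = b' / u ^+ 2 ->
  u ^+ 4 - 2%:R * a * u ^+ 2 + b' = 4%:R * w ^+ 2 * u ^+ 2.
Proof.
move=> Eb Ea u0 b0 Ep.
have quartic (q q' : F) : q = u ^+ 2 -> q * q' = b' ->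
    q + q' = 4%:R * w ^+ 2 + 2%:R * a ->
    u ^+ 4 - 2%:R * a * u ^+ 2 + b' = 4%:R * w ^+ 2 * u ^+ 2.
  move=> Eq <- Es; rewrite (_ : 4%:R * w ^+ 2 = q + q' - 2%:R * a).
    by rewrite Eq; ring.
  by rewrite Es addrK.
case: Ep => Ep; first exact: (quartic p p').
have p0 : p != 0 by rewrite Ep mulf_neq0 ?invr_eq0 ?expf_neq0.
have Ep' : p' = u ^+ 2 by apply: (mulfI p0); rewrite Eb Ep divfK ?expf_neq0.
exact: (quartic p' p Ep' (etrans (mulrC _ _) Eb) (etrans (addrC _ _) Ea)).
Qed.

Lemma descent (w v : rat) : w ^+ 4 + 25%:R * w ^+ 2 - 512%:R = v ^+ 2 ->
  exists w1 u : rat,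
    [/\ w1 != 0, w1 ^+ 4 + 25%:R * w1 ^+ 2 - 512%:R = (u * w1) ^+ 2,
        u ^+ 4 - 50%:R * u ^+ 2 + 2673%:R = 4%:R * w ^+ 2 * u ^+ 2
      & 2%:R * w * u * w1 ^+ 2 = w1 ^+ 4 + 512%:R].
Proof.
move=> E; pose p := 2%:R * w ^+ 2 + 25%:R + 2%:R * v.
pose p' := 2%:R * w ^+ 2 + 25%:R - 2%:R * v.
have ps : p + p' = 4%:R * w ^+ 2 + 2%:R * 25%:R by rewrite /p /p'; ring.
have pp : p * p' = 2673%:R.
  have E4 : w ^+ 4 = v ^+ 2 - 25%:R * w ^+ 2 + 512%:R by rewrite -E; ring.
  by rewrite /p /p'; ring: E4.
have b0 : 2673%:R != 0 :> rat by rewrite pnatr_eq0; exact: isT.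
have p0 : p != 0 by move: b0; rewrite -pp mulf_eq0 => /norP[].
have [|u u0 Eu] := @square_class_50 p (2%:R * w * p) p0.
  by rewrite -pp /p /p'; ring.
have {Eu} Ew : u ^+ 4 - 50%:R * u ^+ 2 + 2673%:R = 4%:R * w ^+ 2 * u ^+ 2.
  by rewrite -(isogeny_quartic pp ps u0 b0 Eu); ring.
pose x := (u ^+ 2 - 25%:R + 2%:R * w * u) / 2%:R.
pose z := (u ^+ 2 - 25%:R - 2%:R * w * u) / 2%:R.
have xBz : x - z = 2%:R * w * u by rewrite /z /x; field.
have xDz : x + z + 25%:R = u ^+ 2 by rewrite /z /x; lra.
have xz : x * z = - 512%:R.
  suff: u ^+ 4 - 50%:R * u ^+ 2 + 2673%:R
      = 4%:R * (x * z + 512%:R) + 4%:R * w ^+ 2 * u ^+ 2.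
    by rewrite Ew; lra.
  by rewrite /x /z; field.
clearbody x z; have x0 : x != 0.
  have: - 512%:R != 0 :> rat by rewrite oppr_eq0 pnatr_eq0; exact: isT.
  by rewrite -xz mulf_eq0 => /norP[].
have [|w1 w10 Ew1] := @square_class_25 x (u * x) x0.
  by rewrite -xz [RHS]exprMn -xDz; ring.
have res (a b c : rat) : a = w1 ^+ 2 -> a * b = - 512%:R ->
    a + b + 25%:R = c ^+ 2 -> a - b = 2%:R * w * c ->
    w1 ^+ 4 + 25%:R * w1 ^+ 2 - 512%:R = (c * w1) ^+ 2 /\
    2%:R * w * c * w1 ^+ 2 = w1 ^+ 4 + 512%:R.
  move=> Ea ab aDb aBb; split.
    by rewrite exprMn -aDb -ab (_ : w1 ^+ 4 = a ^+ 2) ?Ea; ring.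
  by rewrite -aBb -[512%:R]opprK -ab (_ : w1 ^+ 4 = a ^+ 2) ?Ea; ring.
case: Ew1 => Ew1; exists w1.
  have [E1 E2] := res x z u Ew1 xz xDz xBz; exists u.
  by split; [exact: w10 | exact: E1 | exact: Ew | exact: E2].
have Ez : z = w1 ^+ 2.
  by apply: (mulfI x0); rewrite xz Ew1 divfK ?expf_neq0.
have [E1 E2] : w1 ^+ 4 + 25%:R * w1 ^+ 2 - 512%:R = (- u * w1) ^+ 2 /\
    2%:R * w * (- u) * w1 ^+ 2 = w1 ^+ 4 + 512%:R.
  apply: (res z x (- u) Ez); first by rewrite mulrC; exact: xz.
    by rewrite sqrrN [z + x]addrC; exact: xDz.
  by rewrite mulrN -xBz opprB.
have Nu4 : (- u) ^+ 4 = u ^+ 4 by ring.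
exists (- u); split; [exact: w10 | exact: E1 | | exact: E2].
by rewrite sqrrN Nu4; exact: Ew.
Qed.

(** * Height bound for halving, and the finite search it leaves *)

Section Search.
Local Open Scope Z_scope.

(** For negative [f], [Z.sqrt] returns 0, so [f] is correctly treated as a nonsquare. *)
Definition search_ok (m e : Z) : bool :=
  let f := (m ^ 4 + 25 * m ^ 2 * e ^ 2 - 512 * e ^ 4) in
  [|| ~~ Z.eqb (Z.sqrt f * Z.sqrt f) f, Z.eqb m (4 * e) | Z.eqb m (8 * e)].

Lemma search_okP :
  all (fun m => all (fun e => search_ok (Z.of_nat m) (Z.of_nat e)) (iota 1 37))
    (iota 0 177).
Proof. by vm_compute. Qed.

Lemma small_quartic_points (m e n : nat) : (m < 177)%N -> (0 < e < 38)%N ->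
  (n ^ 2 + 512 * e ^ 4 = m ^ 4 + 25 * m ^ 2 * e ^ 2)%N ->
  (m = 4 * e \/ m = 8 * e)%N.
Proof.
move=> m177 e38 E.
have /allP/(_ m) := search_okP; rewrite mem_iota m177 => /(_ isT)/allP/(_ e).
rewrite mem_iota => /(_ e38); rewrite /search_ok.
have -> : (Z.of_nat m ^ 4 + 25 * Z.of_nat m ^ 2 * Z.of_nat e ^ 2
           - 512 * Z.of_nat e ^ 4 = Z.of_nat n * Z.of_nat n) by lia.
rewrite Z.sqrt_square; last by lia.
by rewrite Z.eqb_refl; case/or3P=> // /Z.eqb_eq; lia.
Qed.

End Search.

(** The bounds come from 177^3 > 2048 * 2673 and then 512 * 38^4 > 176 * 2048 * 2673. *)
Lemma size_bound (m m1 e1 : nat) : (m <= m1)%N ->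
  (m1 ^ 4 + 512 * e1 ^ 4 <= m * (2048 * 2673))%N ->
  (m1 < 177)%N /\ (e1 < 38)%N.
Proof.
move=> mm1 E; have m177 : (m1 < 177)%N.
  rewrite ltnNge; apply/negP=> m177.
  have : (177 ^ 3 <= m1 ^ 3)%N by rewrite leq_exp2r.
  by rewrite expnS in E; nia.
split=> //; rewrite ltnNge; apply/negP=> e38.
have : (38 ^ 4 <= e1 ^ 4)%N by rewrite leq_exp2r.
by nia.
Qed.

(* Here w = m / d and w1 = c / e. The constant comes from a resultant: it is in *)
(* the ideal of A and B ^+ 2 up to a power of e, and so bounds gcd(A, B).       *)
Lemma doubling_height (c e n m d : int) : coprimez c e -> m != 0 ->
  c ^+ 4 + 25%:R * c ^+ 2 * e ^+ 2 - 512%:R * e ^+ 4 = n ^+ 2 ->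
  m * (2%:R * n * c * e) = d * (c ^+ 4 + 512%:R * e ^+ 4) ->
  (`|c| ^ 4 + 512 * `|e| ^ 4 <= `|m| * (2048 * 2673))%N.
Proof.
move=> ce m0 En Em.
have eA : coprimez e (c ^+ 4 + 512%:R * e ^+ 4).
  have -> : c ^+ 4 + 512%:R * e ^+ 4 = (512%:R * e ^+ 3) * e + c ^+ 4 by ring.
  rewrite /coprimez gcdzMDl; apply: (@coprimezXr _ e c); rewrite coprimez_sym.
  exact: ce.
set A := c ^+ 4 + 512%:R * e ^+ 4 in Em *.
set B := 2%:R * n * c * e in Em *.
(* The constant is made opaque so that this large unary number is never evaluated. *)
have [K EK] : exists K, K = (2048 * 2673)%N by exists (2048 * 2673)%N.
rewrite -EK; have id : K%:R * e ^+ 10 =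
    (2%:R * c ^+ 2 - 25%:R * e ^+ 2) * B ^+ 2
    - 4%:R * e ^+ 2
      * (2%:R * c ^+ 4 + 25%:R * c ^+ 2 * e ^+ 2 - 2673%:R * e ^+ 4) * A.
  by rewrite /B !exprMn -En /A EK natrM; ring.
pose k := gcdz A B.
have kA : (k %| A)%Z := dvdz_gcdl A B; have kB : (k %| B)%Z := dvdz_gcdr A B.
have ke : coprimez k (e ^+ 10).
  by apply: (coprimez_dvdl kA); apply: coprimezXr; move: eA; rewrite coprimez_sym.
have K0 : (0 < K)%N by rewrite EK muln_gt0.
clear EK.
have kK : (k %| K%:R)%Z.
  rewrite -(Gauss_dvdzl _ ke) id; apply: rpredB; apply: dvdz_mull; last exact: kA.
  by rewrite expr2; apply: dvdz_mull; exact: kB.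
(* [A] divides m A and m B = d A, hence m gcd(A, B), which divides m K. *)
have AK : (A %| m * K%:R)%Z.
  apply: (@dvdz_trans (m * k)); last by apply: dvdz_mul.
  have -> : (A %| m * k)%Z = (A %| gcdz (m * A) (m * B))%Z.
    by rewrite -mulz_gcdr !dvdzE !abszM.
  by rewrite dvdz_gcd Em; apply/andP; split; apply: dvdz_mull; exact: dvdzz.
clear id; move: AK; rewrite dvdzE abszM natz absz_nat => /dvdn_leq.
rewrite muln_gt0 absz_gt0 m0 K0 => /(_ isT).
have -> : A = (`|c| ^ 4 + 512 * `|e| ^ 4)%N%:Z.
  by rewrite PoszD PoszM -!abszX !gez0_abs ?exprn_even_ge0.
by rewrite absz_nat.
Qed.

Lemma quartic_absz (c e n : int) :
  c ^+ 4 + 25%:R * c ^+ 2 * e ^+ 2 - 512%:R * e ^+ 4 = n ^+ 2 ->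
  (`|n| ^ 2 + 512 * `|e| ^ 4 = `|c| ^ 4 + 25 * `|c| ^ 2 * `|e| ^ 2)%N.
Proof.
have sqz (x : int) k : ~~ odd k -> x ^+ k = (`|x| ^ k)%N%:Z.
  by move=> ek; rewrite -abszX gez0_abs // exprn_even_ge0.
rewrite !sqz //.
move: (`|c| ^ 4)%N (`|c| ^ 2)%N (`|e| ^ 4)%N (`|e| ^ 2)%N (`|n| ^ 2)%N.
by move=> c4 c2 e4 e2 n2; lia.
Qed.

Lemma sqr_ratio (c e : int) (k : nat) : e != 0 -> (`|c| = k * `|e|)%N ->
  (c%:~R / e%:~R) ^+ 2 = k%:R ^+ 2 :> rat.
Proof.
move=> e0 Ek; have e0' : e%:~R != 0 :> rat by rewrite intr_eq0.
have Ec : c ^+ 2 = k%:Z ^+ 2 * e ^+ 2 by lia.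
by rewrite expr_div_n -rmorphXn /= Ec rmorphM !rmorphXn /= mulfK ?expf_neq0.
Qed.

(** * Infinite descent and the rational points of E *)

(** Strong induction on the numerator of w: the half w1 is settled by induction if its numerator is
    smaller, by the search otherwise. *)
Lemma quartic_points (w v : rat) : w ^+ 4 + 25%:R * w ^+ 2 - 512%:R = v ^+ 2 ->
  w ^+ 2 = 16%:R \/ w ^+ 2 = 64%:R.
Proof.
move: {-1}`|numq w|%N (leqnn `|numq w|) => h.
elim/ltn_ind: h => h IH in w v *; move=> wh E.
have w0 : w != 0.
  by apply/eqP=> w0; have := sqr_ge0 v; rewrite -E w0; lra.
have [w1 [u [w10 E1 Eu Ew]]] := descent E.
have w12 : w1 ^+ 2 = 16%:R \/ w1 ^+ 2 = 64%:R.
  have [lt_h|le_h] := ltnP `|numq w1| h; first exact: (IH _ lt_h w1 (u * w1)).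
  set c := numq w1 in le_h; set e := denq w1; set m := numq w in wh.
  have e0 : e%:~R != 0 :> rat by rewrite intr_eq0 denq_neq0.
  have d0 : (denq w)%:~R != 0 :> rat by rewrite intr_eq0 denq_neq0.
  have Ew1 : w1 = c%:~R / e%:~R by rewrite divq_num_den.
  have [|n Ey En] := @quartic_frac 1 25 (- 512) w1 (u * w1).
    by rewrite -E1 mul1r.
  have {En} En : c ^+ 4 + 25%:R * c ^+ 2 * e ^+ 2 - 512%:R * e ^+ 4 = n ^+ 2.
    by rewrite -En; ring.
  have Em : m * (2%:R * n * c * e) = denq w * (c ^+ 4 + 512%:R * e ^+ 4).
    have kE : (512%:R : int)%:~R = 512%:R :> rat by exact: mulrz_nat.
    (* Unification would otherwise unfold the numerals. *)
    move: (512%:R : int) (512%:R : rat) kE Ew {E1 En E} => k k' kE Ew.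
    apply: (@intr_inj rat).
    rewrite !(rmorphM, rmorphD, rmorphXn) /= -Ey -/e.
    have -> : m%:~R = w * (denq w)%:~R :> rat by rewrite -numqE.
    have -> : c%:~R = w1 * e%:~R by rewrite Ew1 divfK.
    rewrite kE.
    transitivity ((2%:R * w * u * w1 ^+ 2) * (denq w)%:~R * e%:~R ^+ 4).
      by ring.
    by rewrite Ew; ring.
  have m0 : m != 0 by rewrite numq_eq0.
  have le_m : (`|m| <= `|c|)%N := leq_trans wh le_h.
  have bound := doubling_height (coprime_num_den w1) m0 En Em.
  have [c177 e38] := size_bound le_m bound.
  have Enat : (`|n| ^ 2 + 512 * `|e| ^ 4 = `|c| ^ 4 + 25 * `|c| ^ 2 * `|e| ^ 2)%N.
    exact: quartic_absz.
  have epos : (0 < `|e|)%N by rewrite absz_gt0 denq_neq0.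
  have e_bounds : (0 < `|e| < 38)%N by rewrite epos.
  have [Ec|Ec] := small_quartic_points c177 e_bounds Enat; [left|right].
    by rewrite Ew1 (sqr_ratio (denq_neq0 w1) Ec) -natrX.
  by rewrite Ew1 (sqr_ratio (denq_neq0 w1) Ec) -natrX.
have E4 : w1 ^+ 4 = (w1 ^+ 2) ^+ 2 by rewrite -exprM.
have u4 : u ^+ 4 = (u ^+ 2) ^+ 2 by rewrite -exprM.
rewrite E4 [RHS]exprMn in E1; rewrite u4 in Eu.
(* Doubling exchanges the x-coordinates 16 and 64. *)
case: w12 => Ew1; rewrite Ew1 in E1.
  have Eu2 : u ^+ 2 = 9%:R by lra.
  by right; rewrite Eu2 in Eu; lra.
have Eu2 : u ^+ 2 = 81%:R by lra.
by left; rewrite Eu2 in Eu; lra.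
Qed.

Lemma weierstrass_points (x y : rat) : x * (x ^+ 2 + 25%:R * x - 512%:R) = y ^+ 2 ->
  x \in [:: 0; 16%:R; 64%:R; - 32%:R; - 8%:R].
Proof.
rewrite !inE; have [_ _|x0 E] := eqVneq x 0; first exact: isT.
have [w w0 Ex] := square_class_25 x0 E.
have w20 : w ^+ 2 != 0 by rewrite expf_neq0.
have [v Ev] : exists v, w ^+ 4 + 25%:R * w ^+ 2 - 512%:R = v ^+ 2.
  case: Ex => Ex.
    by exists (y / w); rewrite expr_div_n -E Ex; field; exact: w0.
  exists (y / x * w); rewrite exprMn expr_div_n -E.
  have Exw : - 512%:R = x * w ^+ 2 by rewrite Ex divfK.
  by rewrite Exw; field; exact: x0.
have [Ew|Ew] := quartic_points Ev; case: Ex => Ex; rewrite Ew in Ex; rewrite Ex.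
- by rewrite eqxx.
- by have -> : - 512%:R / 16%:R = - 32%:R :> rat by lra.
- by rewrite eqxx !orbT.
by have -> : - 512%:R / 64%:R = - 8%:R :> rat by lra.
Qed.

(** * From E back to the cubic with h = 12 *)

Lemma scaled_weierstrass_points (z t : rat) :
  z * (64%:R * z ^+ 2 + 25%:R * z - 8%:R) = t ^+ 2 ->
  64%:R * z \in [:: 0; 16%:R; 64%:R; - 32%:R; - 8%:R].
Proof.
move=> E; apply: (@weierstrass_points _ (64%:R * t)).
transitivity (64%:R ^+ 2 * t ^+ 2); last by ring.
by rewrite -E; ring.
Qed.

(** The equation reads x y (11 - s) = (s + 1)^2 with s = x + y. Replacing x y in (x - y)^2 = s^2 - 4
    x y gives E in the coordinate z = (2 - s) / (11 - s) = X / 64. *)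
Lemma affine_points (x y : rat) :
  (x + 1) * (y + 1) * (x + y + 1) - 12%:R * x * y = 0 ->
  (x, y) \in [:: (0, -1); (-1, 0); (1, 1); (2%:R, 3%:R); (3%:R, 2%:R);
                (1, 2%:R); (2%:R, 1)].
Proof.
move=> E; pose k := 11%:R - (x + y).
have Ek : x * y * k = (x + y + 1) ^+ 2.
  by apply/eqP; rewrite -subr_eq0 -oppr_eq0 -E /k; apply/eqP; ring.
have k0 : k != 0.
  apply/eqP=> k0; move: Ek; rewrite k0 (_ : x + y = 11%:R); first by lra.
  by move: k0; rewrite /k; lra.
have Exy : x * y = (x + y + 1) ^+ 2 / k by rewrite -Ek mulfK.
pose z := (k - 9%:R) / k.
have Ez : z * (64%:R * z ^+ 2 + 25%:R * z - 8%:R) = (9%:R * (x - y) / k) ^+ 2.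
  have -> : (9%:R * (x - y) / k) ^+ 2
      = 81%:R * ((x + y) ^+ 2 - 4%:R * (x * y)) / k ^+ 2.
    by field.
  have Es : x + y = 11%:R - k by rewrite /k; ring.
  by rewrite Exy Es /z; field.
have zk : z * k = k - 9%:R by rewrite /z divfK.
have kE : k = 11%:R - (x + y) by [].
clearbody z k.
(* As z is a fractional linear function of x + y, each value other than z = 1 determines the sum,
   and then the product. *)
have sum_prod (c s p : rat) :
    64%:R * z = c -> c * (11%:R - s) = 64%:R * (2%:R - s) -> c != 64%:R ->
    p * (11%:R - s) = (s + 1) ^+ 2 -> 11%:R - s != 0 ->
    x + y = s /\ x * y = p.
  move=> Ec Es c64 Ep s0; have Exys : x + y = s.
    have ck : c * k = 64%:R * (k - 9%:R) by rewrite -Ec -mulrA zk.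
    have c640 : c - 64%:R != 0 by rewrite subr_eq0.
    suff : k = 11%:R - s by rewrite kE => /addrI /oppr_inj.
    by apply: (mulfI c640); rewrite [LHS]mulrBl [RHS]mulrBl ck Es; ring.
  by split; [exact: Exys | apply: (mulIf s0); rewrite Ep -Exys -kE; exact: Ek].
have roots (a b : rat) : x + y = a + b /\ x * y = a * b ->
    (x, y) = (a, b) \/ (x, y) = (b, a).
  move=> [Es Ep]; have Ey : y = a + b - x by rewrite -Es; ring.
  have /eqP : (x - a) * (x - b) = 0.
    have -> : (x - a) * (x - b) = a * b - x * (a + b - x) by ring.
    by rewrite -Ey Ep subrr.
  rewrite Ey mulf_eq0 !subr_eq0 => /orP[]/eqP->; [left | right].
    by congr (_, _); ring.
  by congr (_, _); ring.
have := scaled_weierstrass_points Ez.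
rewrite 4!in_cons mem_seq1.
case/orP=> [/eqP Ec|/orP[/eqP Ec|/orP[/eqP Ec|/orP[]/eqP Ec]]].
- by case: (roots 1 1) => [|->|->];
    [apply: (sum_prod _ _ _ Ec); do ?[by vm_compute | by ring] | | ].
- by case: (roots 0 (-1)) => [|->|->];
    [apply: (sum_prod _ _ _ Ec); do ?[by vm_compute | by ring] | | ].
(* The value z = 1 is reached only at infinity: it would give k = k - 9. *)
- have z1 : z = 1 by apply: (mulfI (x := 64%:R)); [by vm_compute | rewrite Ec mulr1].
  by move: zk; rewrite z1 mul1r => /eqP; rewrite -subr_eq0 opprB addrC subrK.
- by case: (roots 2%:R 3%:R) => [|->|->];
    [apply: (sum_prod _ _ _ Ec); do ?[by vm_compute | by ring] | | ].
by case: (roots 1 2%:R) => [|->|->];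
  [apply: (sum_prod _ _ _ Ec); do ?[by vm_compute | by ring] | | ].
Qed.

(** * The ten points and their torsion *)

Local Notation E12 := (curve (12%:R : rat)).

Definition points : seq (vec rat) :=
  [:: (1, 0, 0); (0, 1, 0); (1, -1, 0)] ++
  [seq (p.1, p.2, 1) | p <- [:: (0, -1); (-1, 0); (1, 1); (2%:R, 3%:R);
    (3%:R, 2%:R); (1, 2%:R); (2%:R, 1)]].

Lemma coords_points (P : E12) : coords P \in points.
Proof.
case: P => [[[x y] z]] /= /andP[]; rewrite /normal /cubic.
have [->|z0] := eqVneq z 0; rewrite /= ?addr0 ?mulr0 ?subr0.
  have [->|x0] := eqVneq x 0; rewrite /=; first by move=> /eqP-> _.
  move=> /eqP->; rewrite mul1r mulf_eq0 addrC addr_eq0.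
  by case/orP=> /eqP->.
move=> /eqP-> /eqP E; rewrite mem_cat; apply/orP; right.
apply: (map_f (fun p : rat * rat => (p.1, p.2, 1)) (x := (x, y))).
by apply: affine_points; rewrite -E mulr1.
Qed.

(** The group law on bare coordinates, free of membership proofs, so that multiples can be
    computed. *)
Definition third_coords (v w : vec rat) : vec rat := normalize (third_vec 12%:R v w).
Definition add_coords (v w : vec rat) : vec rat :=
  third_coords (third_coords v w) (1, -1, 0).

Lemma smooth12 : smooth (12%:R : rat).
Proof. by vm_compute. Qed.

Lemma coords_addE (P Q : E12) : coords (addE P Q) = add_coords P Q.
Proof. by rewrite /addE !coords_third ?smooth12. Qed.

Lemma coords_iter (P : E12) n :
  coords (iter n (addE P) (neutral _)) = iter n (add_coords P) (1, -1, 0).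
Proof. by elim: n => //= n IH; rewrite coords_addE IH. Qed.

Lemma points_torsion :
  all (fun v => iter 10 (add_coords v) (1, -1, 0) == (1, -1, 0)) points.
Proof. by vm_compute. Qed.

Lemma zmul10 (P : E12) : zmul (neutral _) (@addE _ _) (@oppE _ _) 10 P = neutral _.
Proof.
apply/val_inj => /=; have /allP/(_ _ (coords_points P))/eqP := points_torsion.
exact: etrans (coords_iter P 10).
Qed.

Lemma addE_neutral : addE (neutral _) (neutral _) = neutral _ :> E12.
Proof. by apply/val_inj; rewrite /= coords_addE; apply/eqP; vm_compute. Qed.

Lemma hc_plus_lt12 (R : rcfType) : hc_plus R < ratr 12%:R.
Proof.
rewrite /hc_plus ratr_nat; set r := Num.sqrt _.
have r2 : r ^+ 2 = 5%:R by rewrite sqr_sqrtr ?ler0n.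
have r0 : 0 <= r := sqrtr_ge0 _.
by nra.
Qed.

Theorem proposition12 (R : rcfType) :
  exists h : rat, hc_plus R < ratr h /\ mordell_weil_rank h 0.
Proof.
exists 12%:R; split; first exact: hc_plus_lt12.
split; first by exists (fun _ => neutral _) => n _ [].
case=> [//|k] P indep.
(* The relation 10 P_0 = O contradicts independence. *)
pose n (i : 'I_k.+1) : int := if i == ord0 then 10 else 0.
suff /indep/(_ ord0) : \big[@addE _ _/neutral _]_(i < k.+1)
    zmul (neutral _) (@addE _ _) (@oppE _ _) (n i) (P i) = neutral _ by [].
apply: (big_ind (fun Q => Q = neutral _)) => [//|x y -> ->|i _].
  exact: addE_neutral.
by rewrite /n; case: eqP => _; rewrite ?zmul10.
Qed.
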